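(* Let $p\ge 1$, let $\Theta\subset\mathbb{R}^p$, let $\Theta_0\subset\Theta$ be a fixed subset, and for each $n$ let $Y^n\sim P_\theta^n$, $\theta\in\Theta$. Let $\Pi$ be a prior distribution on $\Theta$ and let $d$ be a metric on $\Theta$. Assume that for some positive sequence $(\epsilon_n)$, $$\sup_{\theta^*\in\Theta}\mathrm{E}_{\theta^*}^n\,\Pi\left[d(\theta,\theta^* )>\epsilon_n\mid Y^n\right]=o(1)\quad (n\to\infty).$$ Let $\gamma_0,\gamma_1>0$ be fixed, let $D(\theta,\Theta_0)=d(\theta,\Theta_0)=\inf_{\theta^*\in\Theta_0}d(\theta,\theta^* )$, let $\tau_n=\epsilon_n$, and let $\delta_n^\pi(\tau_n)$ be the test equal to $0$ if $\Pi\{D(\theta,\Theta_0)\le\tau_n\mid Y^n\}\ge\frac{\gamma_0}{\gamma_0+\gamma_1}$ and equal to $1$ otherwise. Then $$\sup_{\theta\in\Theta_0}\mathrm{E}_\theta^n[\delta_n^\pi(\tau_n)]=o(1)\quad\text{and}\quad \sup_{\theta\in\Theta,\ d(\theta,\Theta_0)>2\epsilon_n}\mathrm{E}_\theta^n[1-\delta_n^\pi(\tau_n)]=o(1).$$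
   Context: $\Pi(\cdot\mid Y^n)$ denotes the posterior distribution of $\theta$ given the data $Y^n$ under the prior $\Pi$, and $\mathrm{E}_\theta^n$ denotes expectation when $Y^n\sim P_\theta^n$. The set $\Theta_0$ is nonempty and all sets and functions involved are assumed measurable. The test concerns $H_0:\theta\in\Theta_0$ versus $H_1:\theta\in\Theta\cap\Theta_0^c$; the value $1$ of the test means rejection of $H_0$. *)

(* Defs.v *)
From mathcomp Require Import all_boot all_order all_algebra.
From mathcomp Require Import all_classical all_reals all_analysis measurable_realfun.

Set Implicit Arguments.
Unset Strict Implicit.
Unset Printing Implicit Defensive.

Import Order.TTheory GRing.Theory Num.Theory.
Import numFieldNormedType.Exports.

Local Open Scope classical_set_scope.
Local Open Scope ring_scope.

(* R^p as a measurable space, with its Borel sigma-algebra. *)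
Notation borel_rV R p := (g_sigma_algebraType (@open 'rV[R]_p)).

(* Throughout, a parameter set Theta is a subset of an ambient type E; functions
   on Theta are total functions on E whose values off Theta are irrelevant. *)

Definition is_metric_on (E : Type) (R : realType) (Theta : set E)
    (d : E -> E -> R) : Prop :=
  [/\ forall x y, Theta x -> Theta y -> 0 <= d x y,
      forall x y, Theta x -> Theta y -> (d x y = 0 <-> x = y),
      forall x y, Theta x -> Theta y -> d x y = d y x &
      forall x y z, Theta x -> Theta y -> Theta z -> d x z <= d x y + d y z].

Definition dist_to_set (E : Type) (R : realType) (d : E -> E -> R) (A : set E)
    (t : E) : R :=
  inf [set d t s | s in A].

(* Supremum over A of a nonnegative function, taken in [0, +oo]: it is 0 (and
   not -oo) when A is empty. *)
Definition sup_nneg (E : Type) (R : realType) (A : set E) (f : E -> \bar R) :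
    \bar R :=
  ereal_sup (0%E |` [set f t | t in A]).

Section posterior.
Context (dE dY : measure_display) (E : measurableType dE)
  (Y : measurableType dY) (R : realType).

(* Prior predictive law of the observation: A |-> \int_Theta P_t(A) Pi(dt). *)
Definition marginal (Theta : set E) (Pi : probability E R)
    (P : E -> probability Y R) (A : set Y) : \bar R :=
  (\int[Pi]_(t in Theta) P t A)%E.

(* The posterior is a regular conditional distribution of the parameter given
   the observation under the joint law Pi(dt) P_t(dy).  It is determined only
   up to a null set of the marginal; any version is allowed. *)
Definition is_posterior (Theta : set E) (Pi : probability E R)
    (P : E -> probability Y R) (Post : R.-pker Y ~> E) : Prop :=
  (forall y, Post y Theta = 1%E) /\
  (forall (A : set Y) (B : set E), measurable A -> measurable B ->
    B `<=` Theta ->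
    (\int[Pi]_(t in B) P t A = \int[marginal Theta Pi P]_(y in A) Post y B)%E).

(* The value 1 means rejection of the null hypothesis. *)
Definition posterior_test (Theta : set E) (Post : R.-pker Y ~> E)
    (D : E -> R) (gamma0 gamma1 tau : R) (y : Y) : R :=
  if ((gamma0 / (gamma0 + gamma1))%:E
        <= Post y [set t | Theta t /\ (D t <= tau)%R])%E
  then 0 else 1.

End posterior.

(* Main.v *)
(* Let s be the true parameter.  If s lies in Theta_0, every parameter outside
   the neighbourhood {D <= eps_n} is at distance more than eps_n from s; if
   D(s) > 2 eps_n, so is every parameter inside it, by the triangle inequality.
   Hence either kind of error at a data point y forces the posterior mass, given
   y, of {t | d(t, s) > eps_n} above a fixed positive threshold, and by Markov's
   inequality its probability is at most a constant times the expected mass. *)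
Require Import Defs.
From mathcomp Require Import all_boot all_order all_algebra.
From mathcomp Require Import all_classical all_reals all_analysis measurable_realfun.
From mathcomp Require Import lra.

Set Implicit Arguments.
Unset Strict Implicit.
Unset Printing Implicit Defensive.

Import Order.TTheory GRing.Theory Num.Theory.
Import numFieldNormedType.Exports.

Local Open Scope classical_set_scope.
Local Open Scope ring_scope.

Section dist_to_set_facts.
Context (E : Type) (R : realType) (Theta Theta0 : set E) (d : E -> E -> R).
Hypotheses (d_metric : is_metric_on Theta d) (sTheta0 : Theta0 `<=` Theta).

Lemma dist_to_set_le s t : Theta t -> Theta0 s ->
  dist_to_set d Theta0 t <= d t s.
Proof.
have [d_ge0 _ _ _] := d_metric => Tt T0s.
(* The real [inf] lies below the members of a set only once that set is bounded below; nonnegativity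
   of the metric provides the bound 0. *)
by apply: ge_inf; [exists 0 => _ [u /sTheta0 Tu <-]; exact: d_ge0|exists s].
Qed.

(** For each [u] in [Theta0], [D s <= d s u <= d s t + d t u]; then take the infimum over [u].
    Nonemptiness matters because [inf] of the empty set is 0 by default, not infinity. *)
Lemma dist_to_set_triangle s t : Theta0 !=set0 -> Theta s -> Theta t ->
  dist_to_set d Theta0 s <= d s t + dist_to_set d Theta0 t.
Proof.
have [_ _ _ d_tri] := d_metric => -[u0 T0u0] Ts Tt.
rewrite -lerBlDl; apply: lb_le_inf; first by exists (d t u0), u0.
move=> _ [u T0u <-]; rewrite lerBlDl.
exact: le_trans (dist_to_set_le Ts T0u) (d_tri _ _ _ Ts Tt (sTheta0 T0u)).
Qed.

End dist_to_set_facts.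

Lemma sup_nneg_ge0 (E : Type) (R : realType) (A : set E) (f : E -> \bar R) :
  (0 <= sup_nneg A f)%E.
Proof. by apply: ereal_sup_ubound; left. Qed.

Lemma sup_nneg_leZ (E : Type) (R : realType) (A B : set E)
    (f g : E -> \bar R) (c : R) : A `<=` B -> 0 <= c ->
  (forall t, A t -> (f t <= c%:E * g t)%E) ->
  (sup_nneg A f <= c%:E * sup_nneg B g)%E.
Proof.
move=> AB c0 fg; apply: ge_ereal_sup => _ [->|[t At <-]].
  (* This is the value 0 adjoined in [sup_nneg]. *)
  by rewrite mule_ge0// ?lee_fin// sup_nneg_ge0.
apply: le_trans (fg t At) _; apply: lee_wpmul2l; first by rewrite lee_fin.
by apply: ereal_sup_ubound; right; exists t => //; exact: AB.
Qed.

(** Transfers the contraction rate to the error probabilities by squeezing. [A] depends on [n]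
    because the alternatives separated by [2 * eps n] do. *)
Lemma sup_nneg_cvg0 (E : Type) (R : realType) (A : nat -> set E) (B : set E)
    (f g : nat -> E -> \bar R) (c : R) : (forall n, A n `<=` B) -> 0 <= c ->
  (forall n t, A n t -> (f n t <= c%:E * g n t)%E) ->
  sup_nneg B (g n) @[n --> \oo] --> 0%E ->
  sup_nneg (A n) (f n) @[n --> \oo] --> 0%E.
Proof.
move=> AB c0 fg g0.
apply: (@squeeze_cvge _ _ _ _ (cst 0%E) _ (fun n => c%:E * sup_nneg B (g n))%E).
- by apply: nearW => n; rewrite sup_nneg_ge0 sup_nneg_leZ//; exact: fg.
- exact: cvg_cst.
- by rewrite -(mule0 c%:E); exact: cvgeZl.
Qed.

(** Plays the part of Markov's inequality: the indicator of an error is dominated pointwise by a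
    multiple of the posterior mass, and integration preserves this. *)
Lemma expectation_leZ (dY : measure_display) (Y : measurableType dY)
    (R : realType) (P : probability Y R) (f g : Y -> R) (c : R) :
  measurable_fun setT f -> measurable_fun setT g -> 0 <= c ->
  (forall y, 0 <= f y) -> (forall y, 0 <= g y) ->
  (forall y, f y <= c * g y) -> ('E_P[f] <= c%:E * 'E_P[g])%E.
Proof.
move=> mf mg c0 f0 g0 fg; rewrite unlock -ge0_integralZl_EFin//.
- apply: ge0_le_integral => //.
  + by move=> y _; rewrite lee_fin.
  + exact/measurable_EFinP.
  + by apply: measurable_funeM; exact/measurable_EFinP.
  + by move=> y _; rewrite -EFinM lee_fin.
- by move=> y _; rewrite lee_fin.
- exact/measurable_EFinP.
Qed.

Section posterior_test_facts.
Context (dE dY : measure_display) (E : measurableType dE)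
  (Y : measurableType dY) (R : realType).
Context (Theta : set E) (Post : R.-pker Y ~> E) (D : E -> R)
  (gamma0 gamma1 tau : R).
Local Notation N := [set t | Theta t /\ D t <= tau].
Hypotheses (mTheta : measurable Theta) (Post_Theta : forall y, Post y Theta = 1%E).
Hypotheses (gamma0_gt0 : 0 < gamma0) (gamma1_gt0 : 0 < gamma1).
Hypothesis mN : measurable N.
Local Notation delta := (posterior_test Theta Post D gamma0 gamma1 tau).

Lemma posterior_test01 y : 0 <= delta y <= 1.
Proof. by rewrite /posterior_test; case: ifP; rewrite ?lexx ler01. Qed.

Lemma measurable_posterior_test : measurable_fun setT delta.
Proof.
apply: measurable_fun_ifT => //; apply: measurable_fun_lee => //.
exact: measurable_kernel.
Qed.

Lemma fine_posteriorK (A : set E) y : measurable A -> A `<=` Theta ->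
  (fine (Post y A))%:E = Post y A.
Proof.
move=> mA AT; rewrite fineK// ge0_fin_numE//.
by apply: le_lt_trans (ltry 1); rewrite -(Post_Theta y) le_measure ?inE.
Qed.

(** On rejection [N] has mass below [gamma0 / (gamma0 + gamma1)], so [A], which covers the rest of
    [Theta], has mass above [gamma1 / (gamma0 + gamma1)]; the factor is the reciprocal of this
    threshold. *)
Lemma type_I_le (A : set E) y : measurable A -> A `<=` Theta ->
  Theta `<=` N `|` A ->
  delta y <= (gamma0 + gamma1) / gamma1 * fine (Post y A).
Proof.
move=> mA AT TNA; have NT : N `<=` Theta by move=> t [].
have g_gt0 : 0 < gamma0 + gamma1 by exact: addr_gt0.
have : (1 <= Post y N + Post y A)%E.
  rewrite -(Post_Theta y); apply: le_trans (measureU2 _ mN mA).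
  by rewrite le_measure ?inE//; exact: measurableU.
have := fine_ge0 (measure_ge0 (Post y) A).
rewrite /posterior_test.
rewrite -(fine_posteriorK y mN NT) -(fine_posteriorK y mA AT) -EFinD !lee_fin /=.
move: (fine _) (fine _) => a b b0 ab; case: ifPn => [_|].
  by rewrite mulr_ge0// divr_ge0// ltW.
rewrite -ltNge ltr_pdivlMr// => aN.
(* With [a], [b] the masses of [N], [A]: multiply [1 - a <= b] by [gamma0 + gamma1] and use
   [a * (gamma0 + gamma1) < gamma0]. *)
rewrite mulrAC ler_pdivlMr// mul1r; nra.
Qed.

(** On acceptance [N], hence the larger set [A], has mass at least [gamma0 / (gamma0 + gamma1)],
    whose reciprocal is the factor. *)
Lemma type_II_le (A : set E) y : measurable A -> A `<=` Theta -> N `<=` A ->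
  1 - delta y <= (gamma0 + gamma1) / gamma0 * fine (Post y A).
Proof.
move=> mA AT NA; have g_gt0 : 0 < gamma0 + gamma1 by exact: addr_gt0.
have : (Post y N <= Post y A)%E by rewrite le_measure ?inE.
have := fine_ge0 (measure_ge0 (Post y) A).
rewrite /posterior_test.
rewrite -(fine_posteriorK y mN (subset_trans NA AT)) -(fine_posteriorK y mA AT).
rewrite !lee_fin /=.
move: (fine _) (fine _) => a b b0 ab; case: ifPn => [|_].
  rewrite ler_pdivrMr// => aN.
  rewrite subr0 mulrAC ler_pdivlMr// mul1r; nra.
by rewrite subrr mulr_ge0// divr_ge0// ltW.
Qed.

End posterior_test_facts.

Theorem theorem1 (R : realType) (p : nat) (p_ge1 : (1 <= p)%N)
    (Theta Theta0 : set (borel_rV R p))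
    (mTheta : measurable Theta)
    (sTheta0 : Theta0 `<=` Theta) (Theta0_neq0 : Theta0 !=set0)
    (dY : nat -> measure_display) (Y : forall n : nat, measurableType (dY n))
    (P : forall n : nat, borel_rV R p -> probability (Y n) R)
    (mP : forall (n : nat) (A : set (Y n)), measurable A ->
      measurable_fun Theta (fun t => P n t A))
    (Pi : probability (borel_rV R p) R) (Pi_Theta : Pi Theta = 1%E)
    (Post : forall n : nat, R.-pker (Y n) ~> (borel_rV R p))
    (Post_posterior : forall n : nat, is_posterior Theta Pi (P n) (Post n))
    (d : borel_rV R p -> borel_rV R p -> R) (d_metric : is_metric_on Theta d)
    (eps : nat -> R) (eps_gt0 : forall n : nat, 0 < eps n)
    (m_ball : forall (n : nat) (s : borel_rV R p), Theta s ->
      measurable [set t | Theta t /\ eps n < d t s])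
    (m_nbhd : forall n : nat,
      measurable [set t | Theta t /\ dist_to_set d Theta0 t <= eps n])
    (contraction :
      sup_nneg Theta (fun s =>
        'E_(P n s)[fun y => fine (Post n y [set t | Theta t /\ (eps n < d t s)%R])]%E)
        @[n --> \oo] --> 0%E)
    (gamma0 gamma1 : R) (gamma0_gt0 : 0 < gamma0) (gamma1_gt0 : 0 < gamma1) :
  let D := dist_to_set d Theta0 in
  let tau := eps in
  let delta (n : nat) : Y n -> R :=
    posterior_test Theta (Post n) D gamma0 gamma1 (tau n) in
  (sup_nneg Theta0 (fun t => 'E_(P n t)[delta n]%E) @[n --> \oo] --> 0%E) /\
  (sup_nneg [set t | Theta t /\ 2 * eps n < D t]
     (fun t => 'E_(P n t)[fun y => (1 - delta n y)%R]%E) @[n --> \oo] --> 0%E).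
Proof.
move=> D tau delta.
have Post1 n y : Post n y Theta = 1%E by case: (Post_posterior n).
have gamma_ge0 : 0 <= gamma0 + gamma1 by rewrite addr_ge0 ?ltW.
pose far n s := [set t | Theta t /\ eps n < d t s].
have farT n s : far n s `<=` Theta by move=> t [].
have mpost n s : Theta s ->
    measurable_fun setT (fun y => fine (Post n y (far n s))).
  move=> Ts; apply: (measurableT_comp (@fine_measurable _ _ _)) => //.
  by apply: measurable_kernel; exact: m_ball.
have mdelta n : measurable_fun setT (delta n) by exact: measurable_posterior_test.
have delta01 n y : 0 <= delta n y <= 1 by exact: posterior_test01.
split.
- apply: (sup_nneg_cvg0 (c := (gamma0 + gamma1) / gamma1) _ _ _ contraction).
  + by [].
  + by rewrite divr_ge0// ltW.
  + move=> n s T0s; have Ts := sTheta0 _ T0s.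
    apply: expectation_leZ; [by []|exact: mpost|by rewrite divr_ge0// ltW| | |].
    * by move=> y; case/andP: (delta01 n y).
    * by move=> y; exact: fine_ge0.
    * move=> y; apply: type_I_le => //; [exact: m_ball|exact: farT|].
      (* As [s] is in [Theta0], a point [t] within [eps n] of [s] has [D t <= d t s <= eps n]; all
         other points are in [far n s]. *)
      move=> t Tt; have [le_dt|lt_dt] := leP (d t s) (eps n); last by right.
      left; split => //; apply: le_trans le_dt.
      exact: (dist_to_set_le d_metric sTheta0).
- apply: (sup_nneg_cvg0 (c := (gamma0 + gamma1) / gamma0) _ _ _ contraction).
  + by move=> n t [].
  + by rewrite divr_ge0// ltW.
  + move=> n s [Ts Ds].
    apply: expectation_leZ; [|exact: mpost|by rewrite divr_ge0// ltW| | |].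
    * exact: measurable_funB.
    * by move=> y; rewrite subr_ge0; case/andP: (delta01 n y).
    * by move=> y; exact: fine_ge0.
    * move=> y; apply: type_II_le => //; [exact: m_ball|exact: farT|].
      move=> t [Tt Dt]; split => //; have [_ _ d_sym _] := d_metric.
      (* From [2 * eps n < D s <= d s t + D t] and [D t <= eps n] follows [eps n < d s t]; symmetry
         turns this into membership in [far n s]. *)
      have := dist_to_set_triangle d_metric sTheta0 Theta0_neq0 Ts Tt.
      rewrite d_sym// -/D; move: Ds Dt; rewrite /tau; lra.
Qed.
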